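(* Let $q$ be an odd prime power and let $d\ge 2$ be even. For every $\varepsilon>0$ there exists $c>0$ such that the following holds: if $\mathcal{P}\subseteq \mathbb{F}_q^d$ satisfies $|\mathcal{P}|\ge (1+\varepsilon)q^{d/2}$, then the number of distinct spreads determined by $\mathcal{P}$ is at least $cq$.
   Context: For $\mathbf{u},\mathbf{v}\in\mathbb{F}_q^d$, $\mathbf{u}\cdot\mathbf{v}=\sum_{i=1}^d u_iv_i$ and $\|\mathbf{x}\|=\mathbf{x}\cdot\mathbf{x}$. For points $\mathbf{a},\mathbf{b},\mathbf{c}\in\mathbb{F}_q^d$, the spread $S(\mathbf{b},\mathbf{a},\mathbf{c})$ between the vectors $\mathbf{b}-\mathbf{a}$ and $\mathbf{c}-\mathbf{a}$ is $$S(\mathbf{b},\mathbf{a},\mathbf{c})=1-\frac{((\mathbf{b}-\mathbf{a})\cdot(\mathbf{c}-\mathbf{a}))^2}{\|\mathbf{b}-\mathbf{a}\|\,\|\mathbf{c}-\mathbf{a}\|},$$ which is undefined if either factor in the denominator is $0$. The spreads determined by $\mathcal{P}$ are the values $S(\mathbf{b},\mathbf{a},\mathbf{c})\in\mathbb{F}_q$ over all $\mathbf{a},\mathbf{b},\mathbf{c}\in\mathcal{P}$ for which the spread is defined. The paper assumes throughout that $q$ is a large odd prime power. *)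

(* Defs.v *)
From HB Require Import structures.
From mathcomp Require Import all_boot all_order all_algebra.

Set Implicit Arguments.
Unset Strict Implicit.
Unset Printing Implicit Defensive.

Import GRing.Theory.
Local Open Scope ring_scope.

Definition dotv (F : finFieldType) (d : nat) (u v : 'rV[F]_d) : F :=
  \sum_(i < d) u 0 i * v 0 i.

Definition normv (F : finFieldType) (d : nat) (x : 'rV[F]_d) : F := dotv x x.

(* Only meaningful when [spread_defined b a c] holds: otherwise the division
   is by 0 and takes a default value. *)
Definition spread (F : finFieldType) (d : nat) (b a c : 'rV[F]_d) : F :=
  1 - dotv (b - a) (c - a) ^+ 2 / (normv (b - a) * normv (c - a)).

Definition spread_defined (F : finFieldType) (d : nat) (b a c : 'rV[F]_d) : bool :=
  (normv (b - a) != 0) && (normv (c - a) != 0).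

Definition spreads (F : finFieldType) (d : nat) (P : {set 'rV[F]_d}) : {set F} :=
  [set s : F | [exists a in P, exists b in P, exists c in P,
                  spread_defined b a c && (s == spread b a c)]].

(* Main.v *)
Require Import Defs.
From mathcomp Require Import all_boot all_order all_algebra all_fingroup cyclic.
From mathcomp Require Import reals.
From mathcomp Require Import zify ring lra.

(** Call a pair of points isotropic if its difference has norm 0, and put
    [Q = q^(d/2)].  The maps [a |-> |a - b|], indexed by [b], send two given
    distinct points to the same value for a proportion [1/q] of all [b];
    counting collisions and applying Cauchy-Schwarz bounds the number of
    isotropic pairs in [P] by [|P|^2/q + (1 - 1/q) Q |P|].  The same count for
    [v |-> w . v] shows that a set of at least [c Q] vectors of equal nonzero
    norm contains a [u] with at least [c' q] distinct products [u . v].  It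
    therefore suffices to find an apex [a] in [P] that sees the rest of [P] in
    at least [c Q] non-isotropic directions.

    For a large constant [K], remove from [P] one after the other all
    non-isotropic lines that contain more than [K] points, leaving [P0], and
    let [P1] be the removed part.  A point is isotropic to at most two points
    of a non-isotropic line, hence to a proportion at most [2/K] of [P1].  If
    [P0] has more than [(1 + eps/2) Q] points, the isotropic pair bound leaves
    many non-isotropic pairs in [P0], at most [K] of them per direction at each
    apex.  If [P0] and [P1] are both of order [Q], the pairs in [P1 x P0] do
    the same.  Otherwise [|P1| > (1 + eps/2) Q]: a linear map from [F^d] to
    [F^(d/2)] takes at most [Q] values, so at least [|P1| - Q] points of [P1]
    share their value with another one, and averaging over all linear maps
    yields many directions, few of which are isotropic. *)

Set Implicit Arguments.
Unset Strict Implicit.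
Unset Printing Implicit Defensive.

Import Order.TTheory GRing.Theory Num.Theory.
Local Open Scope ring_scope.

(** * Collision counts and Cauchy-Schwarz *)

(** Pairs are ordered and include the diagonal, which makes this the second moment of the fibre
    sizes. *)
Definition coll (T U : finType) (f : T -> U) (A : {set T}) : nat :=
  (\sum_(a in A) \sum_(b in A) (f a == f b))%N.

Lemma cardset_in_sum (T : finType) (A : {set T}) (p : pred T) :
  #|[set a in A | p a]| = (\sum_(a in A) p a)%N.
Proof.
rewrite -sum1_card big_mkcond [RHS]big_mkcond; apply: eq_bigr => a _.
by rewrite inE; case: (a \in A); case: (p a).
Qed.

Lemma cardset_sum (T : finType) (p : pred T) :
  #|[set a | p a]| = (\sum_a p a)%N.
Proof.
rewrite -sum1_card big_mkcond; apply: eq_bigr => a _.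
by rewrite inE; case: (p a).
Qed.

Lemma sum_card_fibers (T U : finType) (f : T -> U) (A : {set T}) :
  (\sum_t #|[set a in A | f a == t]|)%N = #|A|.
Proof.
under eq_bigr => t _ do rewrite cardset_in_sum.
rewrite exchange_big -sum1_card; apply: eq_bigr => a _.
rewrite (bigD1 (f a)) //= eqxx big1 // => t ne.
by rewrite eq_sym (negPf ne).
Qed.

Lemma coll_fibers (T U : finType) (f : T -> U) (A : {set T}) :
  coll f A = (\sum_t #|[set a in A | f a == t]| ^ 2)%N.
Proof.
under [RHS]eq_bigr => t _ do rewrite cardset_in_sum -mulnn big_distrl /=.
rewrite [RHS]exchange_big; apply: eq_bigr => a _ /=.
under [RHS]eq_bigr => t _ do rewrite big_distrr /=.
rewrite [RHS]exchange_big; apply: eq_bigr => b _ /=.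
rewrite (bigD1 (f a)) //= eqxx mul1n big1 ?addn0; first by rewrite eq_sym.
by move=> t ne; rewrite eq_sym (negPf ne).
Qed.

Lemma cauchy_card (R : realFieldType) (T : finType) (A : {set T}) (n : T -> R) :
  (\sum_(t in A) n t) ^+ 2 <= #|A|%:R * \sum_(t in A) n t ^+ 2.
Proof.
have [->|A0] := eqVneq A set0; first by rewrite !big_set0 cards0 mul0r expr0n.
have cA : 0 < #|A|%:R :> R by rewrite ltr0n card_gt0.
set S := \sum_(t in A) n t.
have : 0 <= \sum_(t in A) (#|A|%:R * n t - S) ^+ 2.
  by apply: sumr_ge0 => t _; apply: sqr_ge0.
under eq_bigr => t _.
  rewrite (_ : _ ^+ 2 = #|A|%:R ^+ 2 * n t ^+ 2 - (2 * #|A|%:R * S) * n t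
    + S ^+ 2); last by ring.
  over.
rewrite big_split sumrB /= -!mulr_sumr sumr_const -/S -mulr_natl => h.
by rewrite -(ler_pM2l cA) -subr_ge0; apply: le_trans h _; apply/eqP/eqP; lra.
Qed.

(** Cauchy-Schwarz over the [#|U| - 1] fibres other than the one above [t], whose size is kept
    exact. *)
Lemma coll_ge_fiber (R : realFieldType) (T U : finType) (f : T -> U)
    (A : {set T}) (t : U) (n := #|[set a in A | f a == t]|%:R : R) :
  (#|A|%:R - n) ^+ 2 <= (#|U|%:R - 1) * ((coll f A)%:R - n ^+ 2).
Proof.
have -> : #|A|%:R = n + \sum_(i | i != t) #|[set a in A | f a == i]|%:R.
  by rewrite -(sum_card_fibers f A) (bigD1 t) //= natrD natr_sum.
rewrite coll_fibers [X in _ <= _ * (X%:R - _)](bigD1 t) //= natrD natrX -/n.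
rewrite natr_sum.
under [X in _ <= _ * (_ + X - _)]eq_bigr => i _ do rewrite natrX.
rewrite !(addrC n) addrK (addrC (n ^+ 2)) addrK.
have := cauchy_card [set~ t] (fun t => #|[set a in A | f a == t]|%:R : R).
rewrite cardsC1 -subn1 natrB; last by apply/card_gt0P; exists t.
have E (G : U -> R) : \sum_(i in [set~ t]) G i = \sum_(i | i != t) G i.
  by apply: eq_bigl => i; rewrite !inE.
by rewrite !E.
Qed.

Lemma coll_ge (T U : finType) (f : T -> U) (A : {set T}) (B : {set U}) :
  (forall a, a \in A -> f a \in B) -> (#|A| ^ 2 <= #|B| * coll f A)%N.
Proof.
move=> fAB.
have F0 t : t \notin B -> #|[set a in A | f a == t]| = 0%N.
  move=> tB; apply/eqP; rewrite cards_eq0; apply/eqP/setP => a; rewrite !inE.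
  by apply/negP => /andP [/fAB fa /eqP e]; rewrite -e fa in tB.
have := cauchy_card B (fun t => #|[set a in A | f a == t]|%:R : rat).
rewrite -natr_sum; under [X in _ <= _ * X]eq_bigr => t _ do rewrite -natrX.
rewrite -natr_sum -natrX -natrM ler_nat.
suff E (G : U -> nat) : (forall t, t \notin B -> G t = 0%N) ->
    (\sum_(t in B) G t = \sum_t G t)%N.
  by rewrite !E ?sum_card_fibers ?coll_fibers // => t /F0 ->.
move=> G0; rewrite [RHS](bigID [in B]) /= [X in (_ + X)%N]big1 ?addn0 //.
Qed.

Lemma leq_card_fibers (T U : finType) (f : T -> U) (A : {set T}) (B : {set U})
    (m : nat) :
  (forall a, a \in A -> f a \in B) ->
  (forall t, #|[set a in A | f a == t]| <= m)%N -> (#|A| <= m * #|B|)%N.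
Proof.
move=> fAB fib; rewrite -(sum_card_fibers f A) mulnC -sum_nat_const.
rewrite (bigID [in B]) /= [X in (_ + X)%N]big1 ?addn0 => [|t tB].
  exact: leq_sum.
apply/eqP; rewrite cards_eq0; apply/eqP/setP => a; rewrite !inE.
by apply/negP => /andP [/fAB fa /eqP e]; rewrite -e fa in tB.
Qed.

Lemma leq_card_bigcup (I T : finType) (A : {set I}) (B : I -> {set T}) :
  (#|\bigcup_(i in A) B i| <= \sum_(i in A) #|B i|)%N.
Proof.
apply: (big_ind2 (fun (X : {set T}) n => #|X| <= n)%N) => [|X m Y n hX hY|//].
  by rewrite cards0.
exact: leq_trans (leq_card_setU X Y) (leq_add hX hY).
Qed.

(** * Universal families of maps *)

(** Universal hashing with collision probability exactly [1/#|U|], written as a product to stay in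
    [nat]. *)
Definition universal (W T U : finType) (phi : W -> T -> U) :=
  forall a b, a != b -> (#|[set w | phi w a == phi w b]| * #|U|)%N = #|W|.

(** Diagonal pairs collide for every [w], the others for a proportion [1/#|U|]. The term
    [#|W| * #|A|] stands on the left to avoid a subtraction. *)
Lemma sum_coll (W T U : finType) (phi : W -> T -> U) (A : {set T}) :
  universal phi ->
  (#|U| * (\sum_w coll (phi w) A) + #|W| * #|A| =
    #|W| * (#|A| ^ 2 + #|U| * #|A|))%N.
Proof.
move=> uphi; rewrite /coll exchange_big /=.
under eq_bigr => a _ do rewrite exchange_big /=.
transitivity (\sum_(a in A) #|W| * (#|A| + #|U|))%N; last first.
  by rewrite sum_nat_const; ring.
rewrite big_distrr /= (mulnC #|W|) -sum_nat_const -big_split /=.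
apply: eq_bigr => a aA; rewrite (bigD1 a) //=.
rewrite (eq_bigr (fun=> 1%N)) => [|w _]; last by rewrite eqxx.
rewrite sum1_card mulnDr big_distrr /=.
rewrite (eq_bigr (fun=> #|W|)) => [|b /andP [_ ne]]; last first.
  by rewrite -cardset_sum mulnC uphi // eq_sym.
have -> : (\sum_(i in A | i != a) #|W| = #|A| * #|W| - #|W|)%N.
  by rewrite -sum_nat_const [in RHS](bigD1 a) //= addKn.
have A0 : (0 < #|A|)%N by apply/card_gt0P; exists a.
rewrite -addnA subnK ?leq_pmull //.
by rewrite mulnDr addnC (mulnC #|A|) (mulnC #|U|).
Qed.

(** The fibres of a surjective additive map are translates of one another. *)
Lemma card_additive_fiber (U V : finZmodType) (f : U -> V) (y : V) :
  {morph f : x x' / x + x'} -> (forall z, exists x, f x = z) ->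
  (#|[set x | f x == y]| * #|V| = #|U|)%N.
Proof.
move=> fD fsurj.
have Efib z : #|[set x | f x == z]| = #|[set x | f x == y]|.
  have [x0 fx0] := fsurj (z - y).
  rewrite -(card_imset [set x | f x == y] (addIr x0)); apply: eq_card => x.
  rewrite inE; apply/eqP/imsetP => [fx|[x' + ->]].
    exists (x - x0); last by rewrite subrK.
    by rewrite inE -(inj_eq (addIr (f x0))) -fD subrK fx fx0 addrC subrK.
  by rewrite inE fD fx0 => /eqP ->; rewrite addrC subrK.
rewrite mulnC -sum_nat_const -[RHS]cardsT -[RHS](sum_card_fibers f).
by apply: eq_bigr => z _; rewrite -(Efib z); apply: eq_card => x; rewrite !inE.
Qed.

Lemma leq_sum_subset (T : finType) (A B : {set T}) (f : T -> nat) :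
  A \subset B -> (\sum_(i in A) f i <= \sum_(i in B) f i)%N.
Proof.
move=> sAB; rewrite [leqRHS](big_setID A) /= (setIidPr sAB); exact: leq_addr.
Qed.

Lemma subset_of_card (T : finType) (A : {set T}) (m : nat) : (m <= #|A|)%N ->
  exists2 B : {set T}, B \subset A & #|B| = m.
Proof.
move=> mA; exists [set x in take m (enum A)].
  by apply/subsetP => x; rewrite inE => /mem_take; rewrite mem_enum.
rewrite cardsE (card_uniqP _) ?size_takel -?cardE //.
exact/take_uniq/enum_uniq.
Qed.

(** * The bilinear form and its universal families *)

Section Geometry.
Variables (F : finFieldType) (d : nat).
Implicit Types (u v w x y a b : 'rV[F]_d) (s t : F) (P E : {set 'rV[F]_d}).

Lemma dotvC u v : dotv u v = dotv v u.
Proof. by apply: eq_bigr => i _; rewrite mulrC. Qed.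

Lemma dotvDl u v w : dotv (u + v) w = dotv u w + dotv v w.
Proof. by rewrite -big_split; apply: eq_bigr => i _; rewrite mxE mulrDl. Qed.

Lemma dotvZl s u v : dotv (s *: u) v = s * dotv u v.
Proof. by rewrite mulr_sumr; apply: eq_bigr => i _; rewrite mxE mulrA. Qed.

Lemma dotvDr u v w : dotv w (u + v) = dotv w u + dotv w v.
Proof. by rewrite !(dotvC w) dotvDl. Qed.

Lemma dotvZr s u v : dotv v (s *: u) = s * dotv v u.
Proof. by rewrite !(dotvC v) dotvZl. Qed.

Lemma dotvNl u v : dotv (- u) v = - dotv u v.
Proof. by rewrite -scaleN1r dotvZl mulN1r. Qed.

Lemma dotvNr u v : dotv v (- u) = - dotv v u.
Proof. by rewrite !(dotvC v) dotvNl. Qed.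

Definition dotvE := (dotvDl, dotvDr, dotvNl, dotvNr, dotvZl, dotvZr).

Lemma normvZ s v : normv (s *: v) = s ^+ 2 * normv v.
Proof. by rewrite /normv !dotvE mulrA. Qed.

Lemma normv0 : normv (0 : 'rV[F]_d) = 0.
Proof. by rewrite -(scale0r 0) normvZ expr0n mul0r. Qed.

Lemma normv_sym a b : normv (a - b) = normv (b - a).
Proof. by rewrite -opprB -scaleN1r normvZ sqrrN expr1n mul1r. Qed.

(** Otherwise [1] has additive order 2, which divides [#|F|] by Lagrange. *)
Lemma two_neq0 : odd #|F| -> 2 != 0 :> F.
Proof.
move=> oddF; apply/negP => /eqP two0.
have o2 : #[1%R : F]%g = 2%N.
  have e2 : ((1%R : F) ^+ 2)%g = 1%g by rewrite FinRing.zmodXgE two0.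
  apply: nt_prime_order e2 _ => //.
  by rewrite FinRing.zmod1gE oner_neq0.
have := order_dvdG (in_setT (1%R : F)).
by rewrite o2 cardsT dvdn2 oddF.
Qed.

Lemma card_dotv_eq x t : x != 0 ->
  (#|[set w | dotv w x == t]| * #|F| = #|{: 'rV[F]_d}|)%N.
Proof.
move=> /matrix0Pn [i [j]]; rewrite ord1 => xj0.
apply: (@card_additive_fiber 'rV[F]_d F (fun w => dotv w x) t) => [w w'|z].
  exact: dotvDl.
exists ((z / x 0 j) *: delta_mx 0 j); rewrite dotvZl /dotv (bigD1 j) //=.
rewrite big1 => [|l ne]; last by rewrite mxE eqxx (negPf ne) mul0r.
by rewrite mxE !eqxx mul1r addr0 mulfVK.
Qed.

Lemma universal_dotv : universal (@dotv F d).
Proof.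
move=> a b; rewrite -subr_eq0 => ab.
rewrite -(card_dotv_eq 0 ab); congr (_ * _)%N; apply: eq_card => w.
by rewrite !inE dotvDr dotvNr subr_eq0.
Qed.

(** The quadratic terms in [b] cancel: a collision says that [b] lies on the hyperplane of equation
    [b . 2(a - a') = |a| - |a'|]. *)
Lemma universal_dist : odd #|F| ->
  universal (fun b a : 'rV[F]_d => normv (a - b)).
Proof.
move=> oddF a a' ne.
have ne2 : 2 *: (a - a') != 0.
  by rewrite scaler_eq0 negb_or two_neq0 // subr_eq0.
rewrite -(card_dotv_eq (normv a - normv a') ne2); congr (_ * _)%N.
apply: eq_card => b; rewrite !inE -subr_eq0 -[RHS]subr_eq0 -[RHS]oppr_eq0.
congr (_ == 0); rewrite /normv !dotvE (dotvC a b) (dotvC a' b); ring.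
Qed.

Lemma universal_mulmx k :
  universal (fun (B : 'M[F]_(d, k)) (a : 'rV[F]_d) => a *m B).
Proof.
move=> a b; rewrite -subr_eq0 => /[dup] ab /matrix0Pn [i [j]].
rewrite ord1 => xj0.
rewrite -(@card_additive_fiber _ _ (mulmx (a - b) : 'M_(d, k) -> 'rV_k) 0).
- congr (_ * _)%N; apply: eq_card => B.
  by rewrite !inE mulmxBl subr_eq0.
- by move=> B B'; rewrite mulmxDr.
(* The only nonzero row of the witness is row [j], where [a - b] has a nonzero entry. *)
- move=> z; exists (delta_mx j 0 *m (((a - b) 0 j)^-1 *: z)).
  rewrite mulmxA -colE -scalemxAr.
  apply/rowP => l; rewrite !mxE big_ord1 !mxE.
  by move: xj0; rewrite !mxE => xj0; rewrite mulrA mulVf // mul1r.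
Qed.

(** * Quadratic equations and square classes *)

Lemma card_quadratic_roots (A B C : F) : A != 0 ->
  (#|[set s : F | (A * s ^+ 2 + B * s + C == 0)%R]| <= 2)%N.
Proof.
move=> A0; pose p : {poly F} := A *: 'X^2 + B *: 'X + C%:P.
have sp : size p = 3.
  rewrite /p -addrA size_polyDl ?size_scale ?size_polyXn //.
  rewrite (leq_ltn_trans (size_polyD _ _)) // gtn_max.
  rewrite (leq_ltn_trans (size_scale_leq _ _)) ?size_polyX //.
  by rewrite (leq_ltn_trans (size_polyC_leq1 _)).
have p0 : p != 0 by rewrite -size_poly_gt0 sp.
set S := [set s | _]; have Sroots : all (root p) (enum S).
  by apply/allP => s; rewrite mem_enum inE /root /p !hornerE.
by have := max_poly_roots p0 Sroots (enum_uniq _); rewrite sp ltnS cardE.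
Qed.

(** Squaring is at most two-to-one, so the nonzero squares [S] fill at least half of [Fx]; if some
    [g] is missed, [S] and its disjoint translate by [g] fill all of it. *)
Lemma square_classes : exists2 g : F, g != 0 &
  forall x : F, x != 0 -> exists2 s : F, s != 0 & x = s ^+ 2 \/ x = s ^+ 2 * g.
Proof.
pose Fx := [set~ 0 : F].
pose S := [set s ^+ 2 | s in Fx].
have FxE (x : F) : (x \in Fx) = (x != 0) by rewrite !inE.
have SP (x : F) : x \in S -> exists2 s : F, s != 0 & x = s ^+ 2.
  by case/imsetP => s; rewrite FxE => s0 ->; exists s.
have [allS|] := boolP [forall x : F, (x != 0) ==> (x \in S)].
  exists 1; rewrite ?oner_neq0 // => x x0.
  have := forallP allS x; rewrite x0 => /SP [s s0 ->].
  by exists s => //; left.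
case/forallPn => g; rewrite negb_imply => /andP [g0 gS].
exists g => // x x0.
have [/SP [s s0 ->]|xS] := boolP (x \in S); first by exists s => //; left.
suff : x \in [set y * g | y in S].
  by case/imsetP => y /SP [s s0 ->] ->; exists s => //; right.
have gS_S : [disjoint S & [set y * g | y in S]].
  apply/pred0P => y /=; apply/negP => /andP [/SP [s s0 ->]].
  case/imsetP => z /SP [r r0 ->] e; case/negP: gS; apply/imsetP.
  exists (s / r); first by rewrite FxE mulf_neq0 ?invr_neq0.
  by rewrite expr_div_n e mulrC mulKf // expf_neq0.
have cS : (#|Fx| <= 2 * #|S|)%N.
  apply: (leq_card_fibers (f := fun s => s ^+ 2)%R) => [s sF|y].
    by apply/imsetP; exists s.
  apply: leq_trans (card_quadratic_roots 0 (- y) (oner_neq0 F)).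
  apply/subset_leq_card/subsetP => s; rewrite !inE => /andP [_ /eqP ->].
  by rewrite mul1r mul0r addr0 subrr.
have sub : S :|: [set y * g | y in S] \subset Fx.
  apply/subsetP => y; rewrite FxE inE => /orP [/SP [s s0 ->]|].
    exact: expf_neq0.
  by case/imsetP => z /SP [s s0 ->] ->; rewrite mulf_neq0 ?expf_neq0.
have : x \in Fx by rewrite FxE.
have /eqP <- : S :|: [set y * g | y in S] == Fx.
  rewrite eqEcard sub cardsU (disjoint_setI0 gS_S) cards0 subn0.
  by rewrite card_imset ?addnn -?mul2n //; apply: mulIf.
by rewrite inE (negPf xS).
Qed.

(** * Isotropic pairs *)

(** The point [b] itself is counted when it lies in [P]. *)
Definition iso P b : nat := #|[set a in P | normv (a - b) == 0]|.

Lemma sum_isoC P P' :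
  (\sum_(a in P) iso P' a = \sum_(b in P') iso P b)%N.
Proof.
under eq_bigr => a _ do rewrite /iso cardset_in_sum.
rewrite exchange_big; apply: eq_bigr => b _ /=; rewrite /iso cardset_in_sum.
by apply: eq_bigr => a _; rewrite normv_sym.
Qed.

(* For each [b] the deviations from the mean of the [q] fibre sizes of
   [a |-> |a - b|] sum to zero; through [coll_ge_fiber] this gains the factor
   [1 - 1/q] in the error term, needed for small [q]. *)
Lemma iso_pairs_bound P (Q : nat) : odd #|F| -> (#|F| ^ d = Q ^ 2)%N ->
  (#|F| * (\sum_(b in P) iso P b) + Q * #|P| <= #|P| ^ 2 + #|F| * Q * #|P|)%N.
Proof.
move=> oddF qd.
pose q : rat := #|F|%:R; pose p : rat := #|P|%:R.
pose x b : rat := (iso P b)%:R.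
pose f b a := normv (a - b); pose c b : rat := (coll (f b) P)%:R.
have q1 : 1 < q by rewrite ltr1n card_finNzRing_gt1.
have Q0 : 0 < Q%:R :> rat.
  rewrite ltr0n lt0n; apply/negP => /eqP Q0.
  move: qd; rewrite Q0 exp0n // => /eqP.
  by rewrite expn_eq0 -leqn0 leqNgt (ltn_trans _ (card_finNzRing_gt1 F)).
have G b : (q * x b - p) ^+ 2 <= (q - 1) * (q * c b - p ^+ 2).
  have h : (p - x b) ^+ 2 <= (q - 1) * (c b - x b ^+ 2).
    exact: coll_ge_fiber.
  (* After multiplication by [q], the identity [q (p - x)^2 + (q - 1)(q x^2 - p^2) = (q x - p)^2]
     gives the claim. *)
  have := ler_wpM2l (ltW (lt_trans ltr01 q1)) h.
  by move: (x b) (c b) => X C; lra.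
have G0 b : 0 <= q * c b - p ^+ 2.
  have q10 : 0 < q - 1 by rewrite subr_gt0.
  by rewrite -(pmulr_rge0 _ q10); apply: le_trans (G b); apply: sqr_ge0.
have sumG : \sum_b (q * c b - p ^+ 2) = Q%:R ^+ 2 * (q - 1) * p.
  have := sum_coll P (universal_dist oddF); rewrite card_mx mul1n qd.
  move/(congr1 (fun m => m%:R : rat)).
  rewrite !(natrD, natrM, natrX) natr_sum -/q -/p => h.
  rewrite sumrB -mulr_sumr sumr_const card_mx mul1n qd.
  rewrite -[_ *+ (Q ^ 2)]mulr_natl natrX.
  rewrite -/(c _); set X := \sum_i _ in h *; nra.
pose L := (q - 1) * Q%:R.
have L0 : 0 < L by rewrite mulr_gt0 // subr_gt0.
(* The sum over all [b] is restricted to [P]; by [G0] the dropped terms are nonnegative. *)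
have sumx2 : \sum_(b in P) (q * x b - p) ^+ 2 <= L ^+ 2 * p.
  have -> : L ^+ 2 * p = (q - 1) * \sum_b (q * c b - p ^+ 2).
    by rewrite sumG /L; ring.
  rewrite [X in _ <= _ * X](bigID [in P]) /= mulrDr mulr_sumr.
  rewrite -[X in X <= _]addr0 lerD //.
    by apply: ler_sum => b _.
  by rewrite mulr_ge0 ?sumr_ge0 // subr_ge0 ltW.
(* Termwise [2 L y <= y^2 + L^2] replaces Cauchy-Schwarz and its square root. *)
have sumx : 2 * L * \sum_(b in P) (q * x b - p) <= 2 * L * (L * p).
  rewrite mulr_sumr.
  have -> : 2 * L * (L * p) = L ^+ 2 * p + L ^+ 2 * p by ring.
  apply: (@le_trans _ _ (\sum_(b in P) ((q * x b - p) ^+ 2 + L ^+ 2))).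
    by apply: ler_sum => b _; have := sqr_ge0 (q * x b - p - L); nra.
  by rewrite big_split sumr_const -[_ *+ #|P|]mulr_natr lerD.
have {}sumx : \sum_(b in P) (q * x b - p) <= L * p.
  by rewrite -(ler_pM2l (mulr_gt0 (ltr0Sn _ 1) L0)).
rewrite sumrB -mulr_sumr sumr_const in sumx.
rewrite -(ler_nat rat) !(natrD, natrM, natrX) natr_sum -/q -/p.
move: sumx; rewrite -mulr_natr /L -/p; set X := \sum_(_ in P) _; lra.
Qed.

(** * Dot products on a sphere *)

(** The excess [G u] is nonnegative and unchanged when [u] is scaled by [s != 0]. A vector [w]
    equals [s *: u] with [u] in [E] at most twice, since [s^2 lam = |w|]. Hence [q - 1] times the
    sum of [G] over [E] is at most twice its sum over the whole space, and some [u] is no worse than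
    average. *)
Lemma pinned_collisions E lam : lam != 0 ->
  (forall v, v \in E -> normv v = lam) ->
  E != set0 ->
  exists2 u, u \in E & (#|F| * coll (dotv u) E <= #|E| ^ 2 + 2 * #|F| ^ d)%N.
Proof.
move=> lam0 normE E0.
pose q : rat := #|F|%:R; pose e : rat := #|E|%:R.
pose c u : rat := (coll (dotv u) E)%:R; pose G u := q * c u - e ^+ 2.
have q1 : 1 < q by rewrite ltr1n card_finNzRing_gt1.
have e0 : 0 < e by rewrite ltr0n card_gt0.
have G0 u : 0 <= G u.
  have /(_ [set: F]) := coll_ge (f := dotv u) (A := E).
  rewrite cardsT -(ler_nat rat) natrM natrX subr_ge0; apply=> v _.
  exact: in_setT.
have sumG : \sum_u G u = q ^+ d * (q - 1) * e.
  have := sum_coll E universal_dotv; rewrite card_mx mul1n.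
  move/(congr1 (fun m => m%:R : rat)).
  rewrite !(natrD, natrM, natrX) natr_sum -/q -/e => h.
  rewrite sumrB -mulr_sumr sumr_const card_mx mul1n.
  rewrite -[_ *+ (_ ^ d)]mulr_natl natrX -/q.
  rewrite -/(c _); set X := \sum_i _ in h *; nra.
have GZ s u : s != 0 -> G (s *: u) = G u.
  move=> s0; rewrite /G /c; congr (q * _%:R - _).
  apply: eq_bigr => v _; apply: eq_bigr => w _.
  by rewrite !dotvZl (inj_eq (mulfI s0)).
have mult w : (\sum_(s | s != 0%R) \sum_(u in E) (s *: u == w) <= 2)%N.
  apply: leq_trans (card_quadratic_roots 0 (- normv w) lam0).
  rewrite cardset_sum big_mkcond /=; apply: leq_sum => s _.
  case: eqP => // /eqP s0; rewrite -cardset_in_sum.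
  have [->|] := eqVneq [set u in E | s *: u == w] set0; first by rewrite cards0.
  case/set0Pn => u; rewrite inE => /andP [uE /eqP uw].
  rewrite -uw normvZ (normE _ uE) mul0r addr0 mulrC subrr eqxx.
  apply: (@leq_trans #|[set u]|); last by rewrite cards1.
  apply/subset_leq_card/subsetP => v; rewrite !inE.
  by case/andP => _; rewrite (inj_eq (scalerI s0)).
have le2 : (q - 1) * \sum_(u in E) G u <= 2 * (q ^+ d * (q - 1) * e).
  have -> : (q - 1) * \sum_(u in E) G u =
      \sum_(s | s != 0%R) \sum_(u in E) G (s *: u).
    rewrite [RHS](eq_bigr (fun=> \sum_(u in E) G u)) => [|s s0]; last first.
      by apply: eq_bigr => u _; rewrite GZ.
    rewrite sumr_const (_ : #|_| = #|F|.-1); last first.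
      by rewrite -(cardC1 (0 : F)); apply: eq_card.
    by rewrite -mulr_natl -subn1 natrB // ltnW // card_finNzRing_gt1.
  have -> : \sum_(s | s != 0%R) \sum_(u in E) G (s *: u) =
      \sum_w (\sum_(s | s != 0%R) \sum_(u in E) (s *: u == w))%N%:R * G w.
    under [RHS]eq_bigr => w _.
      rewrite natr_sum mulr_suml; under eq_bigr => s _ do
        rewrite natr_sum mulr_suml.
      over.
    rewrite [RHS]exchange_big; apply: eq_bigr => s _ /=.
    rewrite [RHS]exchange_big; apply: eq_bigr => u _ /=.
    rewrite (bigD1 (s *: u)) //= eqxx mul1r big1 ?addr0 // => w ne.
    by rewrite eq_sym (negPf ne) mul0r.
  rewrite -sumG mulr_sumr; apply: ler_sum => w _.
  by rewrite ler_wpM2r // (ler_nat rat _ 2).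
have {}le2 : \sum_(u in E) G u <= 2 * q ^+ d * e.
  rewrite -(ler_pM2l (_ : 0 < q - 1)) ?subr_gt0 //.
  by apply: le_trans le2 _; lra.
have [/exists_inP //|/exists_inPn h] := boolP [exists u in E,
  (#|F| * coll (dotv u) E <= #|E| ^ 2 + 2 * #|F| ^ d)%N].
have : \sum_(u in E) (2 * q ^+ d) < \sum_(u in E) G u.
  apply: ltr_sum.
    case/set0Pn: E0 => u uE; apply/hasP.
    by exists u; rewrite ?mem_index_enum.
  move=> u /h; rewrite -ltnNge -(ltr_nat rat).
  rewrite !(natrD, natrM, natrX) -/q -/e -/(c u).
  by rewrite /G; lra.
by rewrite sumr_const -[_ *+ #|E|]mulr_natr -/e ltNge le2.
Qed.

(** * Lines and the removal of rich ones *)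

Definition line a v : {set 'rV[F]_d} := [set a + s *: v | s in [set: F]].

(** Along the line, the norm of the difference to [b] is a quadratic polynomial in [s] with leading
    coefficient [normv v]. *)
Lemma iso_line_le2 P a v b : normv v != 0 -> (iso (P :&: line a v) b <= 2)%N.
Proof.
move=> v0.
pose S := [set s : F | normv v * s ^+ 2 + 2 * dotv v (a - b) * s
                        + normv (a - b) == 0].
apply: leq_trans (card_quadratic_roots (2 * dotv v (a - b)) (normv (a - b)) v0).
apply: leq_trans (leq_imset_card (fun s => a + s *: v) S).
apply/subset_leq_card/subsetP => c; rewrite !inE => /andP [/andP [_]].
case/imsetP => s _ -> /eqP e; apply/imsetP; exists s => //; rewrite inE -e.
apply/eqP; rewrite /normv !dotvE (dotvC v a) (dotvC v b) (dotvC b a); ring.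
Qed.

(** Induction on [#|P|]: each removal takes more than [K] points, at most two of them isotropic to
    [b], and these proportions add up over the disjoint pieces. *)
Lemma remove_rich_lines (K : nat) P : (0 < K)%N ->
  exists2 P0 : {set 'rV[F]_d}, P0 \subset P &
    (forall a v, normv v != 0%R -> #|P0 :&: line a v| <= K)%N /\
    (forall b, K * iso (P :\: P0) b <= 2 * #|P :\: P0|)%N.
Proof.
move=> K0; have [n] := ubnP #|P|; elim: n P => // n IHn P Pn.
have [/forallP h|] := boolP [forall a, forall v,
    (normv v != 0) ==> (#|P :&: line a v| <= K)%N].
  exists P => //; split=> [a v v0|b].
    by have /forallP /(_ v) /implyP := h a; apply.
  rewrite setDv cards0 muln0 leqn0 muln_eq0 -leqn0 leqNgt K0 /=.
  by rewrite cards_eq0; apply/eqP/setP => a; rewrite !inE.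
case/forallPn => a /forallPn [v]; rewrite negb_imply -ltnNge => /andP [v0 rich].
have [|P0 P0P [nr ni]] := IHn (P :\: line a v).
  have := cardsID (line a v) P; lia.
have P0P' : P0 \subset P := subset_trans P0P (subsetDl _ _).
exists P0 => //; split=> // b.
have -> : P :\: P0 = (P :&: line a v) :|: (P :\: line a v :\: P0).
  apply/setP => c; have := subsetP P0P c; rewrite !inE.
  by case: (c \in P0); case: (c \in P); case: (c \in line a v) => // /(_ isT).
have dis : [disjoint P :&: line a v & P :\: line a v :\: P0].
  apply/pred0P => c; rewrite !inE /=.
  by case: (c \in line a v); rewrite ?andbF.
rewrite cardsU (disjoint_setI0 dis) cards0 subn0.
have h1 := iso_line_le2 P a b v0; have h2 := ni b.
have : (iso (P :&: line a v :|: P :\: line a v :\: P0) b <=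
  iso (P :&: line a v) b + iso (P :\: line a v :\: P0) b)%N.
  apply: leq_trans (leq_card_setU _ _); apply/subset_leq_card/subsetP => c.
  by rewrite !inE andb_orl.
nia.
Qed.

(** * Directions seen from an apex *)

(** The condition [s != 0] prevents the apex itself from witnessing every [v]. A direction occurs
    with both signs. *)
Definition dirs t P a : {set 'rV[F]_d} :=
  [set v | (normv v == t) &&
    [exists b in P, exists s : F, (s != 0) && (b == a + s *: v)]].

Lemma dirsS t P P' a : P \subset P' -> dirs t P a \subset dirs t P' a.
Proof.
move=> sPP'; apply/subsetP => v; rewrite !inE.
case/andP=> -> /exists_inP [b bP h].
by apply/exists_inP; exists b => //; apply: (subsetP sPP').
Qed.

Section NonSquare.
Variable g : F.
Hypothesis g0 : g != 0.
Hypothesis gP :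
  forall t, t != 0 -> exists2 s : F, s != 0 & t = s ^+ 2 \/ t = s ^+ 2 * g.

(* Each non-isotropic direction is represented by vectors of norm 1 or [g]. *)
Definition alldirs P a := dirs 1 P a :|: dirs g P a.

Lemma alldirsS P P' a : P \subset P' -> alldirs P a \subset alldirs P' a.
Proof. by move=> sPP'; apply: setUSS; apply: dirsS. Qed.

Lemma alldirs_norm P a v : v \in alldirs P a -> normv v != 0.
Proof. by rewrite !inE => /orP [] /andP [/eqP -> _]; rewrite ?oner_neq0. Qed.

Lemma alldirsP P a b : b \in P -> normv (b - a) != 0 ->
  exists2 v, v \in alldirs P a & exists s, b = a + s *: v.
Proof.
move=> bP n0; have [s s0 e] := gP n0.
have eb : b = a + s *: (s^-1 *: (b - a)).
  by rewrite scalerA mulfV // scale1r addrC subrK.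
exists (s^-1 *: (b - a)); last by exists s.
have ex : [exists b' in P, exists s' : F,
    (s' != 0) && (b' == a + s' *: (s^-1 *: (b - a)))].
  apply/exists_inP; exists b => //.
  by apply/existsP; exists s; rewrite s0 -eb eqxx.
by rewrite !inE ex !andbT normvZ exprVn; case: e => ->;
  rewrite ?mulKf ?mulVf ?expf_neq0 // eqxx ?orbT.
Qed.

(** The points of [P0] not isotropic to [a] are covered by the lines through [a] along
    [alldirs P a]. *)
Lemma noniso_le_dirs (K : nat) P P0 a : P0 \subset P ->
  (forall v, normv v != 0%R -> #|P0 :&: line a v| <= K)%N ->
  (#|P0| <= iso P0 a + K * #|alldirs P a|)%N.
Proof.
move=> sP0 nr; rewrite -(cardsID [set b | normv (b - a) == 0] P0).
apply: leq_add.
  by apply/subset_leq_card/subsetP => b; rewrite !inE.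
apply: (@leq_trans #|\bigcup_(v in alldirs P a) (P0 :&: line a v)|).
  apply/subset_leq_card/subsetP => b; rewrite !inE => /andP [n0 bP0].
  have [v vD [s eb]] := alldirsP (subsetP sP0 _ bP0) n0.
  apply/bigcupP; exists v => //; rewrite inE bP0 /=.
  by apply/imsetP; exists s; rewrite ?inE.
apply: leq_trans (leq_card_bigcup _ _) _; rewrite mulnC -sum_nat_const.
by apply: leq_sum => v /alldirs_norm /nr.
Qed.

(** Union bound over a random [B]: if [a] has a collision partner, [B] merges [a] with another point
    isotropic to it or kills a vector of [alldirs P a]. Each such event has probability [1/Q]. *)
Lemma linear_hashing_dirs P k (Q := (#|F| ^ k)%N) :
  (Q * #|P| <= Q ^ 2 + \sum_(a in P) (iso P a + #|alldirs P a|))%N.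
Proof.
pose M := #|{: 'M[F]_(d, k)}|.
have cV : #|{: 'rV[F]_k}| = Q by rewrite card_mx mul1n.
have M0 : (0 < M)%N by apply/card_gt0P; exists 0.
pose good (B : 'M[F]_(d, k)) a :=
  [exists b in P, (b != a) && (a *m B == b *m B)].
(* The points without a collision partner are mapped injectively. *)
have few_bad B : (#|P| <= Q + \sum_(a in P) good B a)%N.
  rewrite -cardset_in_sum addnC -(cardsID [set a | good B a] P); apply: leq_add.
    by apply/subset_leq_card/subsetP => a; rewrite !inE.
  rewrite -cV; apply: (@leq_card_in _ _ (fun a => a *m B)) => a b.
  rewrite !inE => /andP [nga aP] /andP [_ bP] /eqP eB; apply/eqP.
  apply/negPn; apply/negP => ab; case/negP: nga; apply/exists_inP.
  by exists b; rewrite // eq_sym ab.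
have coll_bound a b : a != b ->
    (#|[set B : 'M_(d, k) | a *m B == b *m B]| * Q)%N = M.
  by move=> ab; rewrite -cV; apply: universal_mulmx ab.
have good_bound a : (Q * \sum_B good B a <= M * (iso P a + #|alldirs P a|))%N.
  rewrite -cardset_sum.
  pose I := [set b in P | normv (b - a) == 0] :\ a.
  pose X := \bigcup_(b in I) [set B : 'M_(d, k) | a *m B == b *m B].
  pose Y := \bigcup_(v in alldirs P a) [set B : 'M_(d, k) | v *m B == 0 *m B].
  have sub : [set B | good B a] \subset X :|: Y.
    apply/subsetP => B; rewrite inE => /exists_inP [b bP /andP [ba /eqP e]].
    rewrite inE; have [n0|n0] := eqVneq (normv (b - a)) 0.
      apply/orP; left; apply/bigcupP.
      by exists b; rewrite !inE ?ba ?bP ?n0 ?e eqxx.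
    have [v vD [s eb]] := alldirsP bP n0.
    have s0 : s != 0.
      by apply: contraNneq ba => s0; rewrite eb s0 scale0r addr0.
    apply/orP; right; apply/bigcupP; exists v => //; rewrite inE mul0mx.
    move: e; rewrite eb mulmxDl -[LHS]addr0 => /addrI /esym /eqP.
    by rewrite -scalemxAl scaler_eq0 (negPf s0).
  apply: (@leq_trans (Q * (#|X| + #|Y|))).
    by rewrite leq_mul2l (leq_trans (subset_leq_card sub)) ?leq_card_setU ?orbT.
  rewrite !mulnDr; apply: leq_add.
    apply: (@leq_trans
        (Q * \sum_(b in I) #|[set B : 'M_(d, k) | a *m B == b *m B]|)).
      by rewrite leq_mul2l leq_card_bigcup orbT.
    rewrite big_distrr /= (eq_bigr (fun=> M)) => [|b]; last first.
      by rewrite !inE mulnC => /andP [ba _]; rewrite coll_bound // eq_sym.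
    by rewrite sum_nat_const mulnC leq_mul2l subset_leq_card ?orbT ?subsetDl.
  apply: (@leq_trans
      (Q * \sum_(v in alldirs P a) #|[set B : 'M_(d, k) | v *m B == 0 *m B]|)).
    by rewrite leq_mul2l leq_card_bigcup orbT.
  rewrite big_distrr /=.
  rewrite (eq_bigr (fun=> M)) => [|v /alldirs_norm v0]; last first.
    rewrite mulnC coll_bound //; apply: contraNneq v0 => ->.
    by rewrite normv0.
  by rewrite sum_nat_const mulnC.
rewrite -(leq_pmul2l M0).
have : (Q * (M * #|P|) <= Q * (M * Q + \sum_B \sum_(a in P) good B a))%N.
  rewrite leq_mul2l; apply/orP; right.
  by rewrite -!sum_nat_const -big_split; apply: leq_sum.
have : (Q * \sum_B \sum_(a in P) good B a <=
        M * \sum_(a in P) (iso P a + #|alldirs P a|))%N.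
  by rewrite exchange_big !big_distrr /=; apply: leq_sum.
rewrite mulnDr; lia.
Qed.

(** The integer [N] plays the role of [1/eps]. The three cases are those of the overview, and the
    constant covers the worst of them. *)
Lemma sum_dirs_ge P (k Q N : nat) :
  Q = (#|F| ^ k)%N -> odd #|F| -> d = (k + k)%N ->
  (0 < N)%N -> (N.+1 * Q <= N * #|P|)%N -> (#|P| <= 2 * Q)%N ->
  (Q ^ 2 <= 256 * N ^ 3 * \sum_(a in P) #|alldirs P a|)%N.
Proof.
move=> eQ oddF dk N0 P_big P_small; set S := (\sum_(a in P) _)%N.
have qd : (#|F| ^ d = Q ^ 2)%N by rewrite dk expnD -eQ mulnn.
have q1 : (1 < #|F|)%N := card_finNzRing_gt1 F.
(* With this [K], [P1] has at most [Q^2 / (2N)] isotropic pairs, less than the surplus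
   [3 Q^2 / (4N)] of the last case. *)
pose K := (16 * N)%N; have K0 : (0 < K)%N by rewrite muln_gt0.
have [P0 sP0 [nr ni]] := remove_rich_lines P K0.
set P1 := P :\: P0 in ni.
have sP1 : P1 \subset P := subsetDl _ _.
have cP : (#|P| = #|P0| + #|P1|)%N.
  by rewrite -(cardsID P0 P) (setIidPr sP0).
have dirsP0 a : (#|P0| <= iso P0 a + K * #|alldirs P a|)%N.
  by apply: noniso_le_dirs => // v; apply: nr.
have sum_sub (A : {set 'rV[F]_d}) : A \subset P ->
    (\sum_(a in A) #|alldirs P a| <= S)%N.
  exact: leq_sum_subset.
have sumP0 (A : {set 'rV[F]_d}) : A \subset P ->
    (#|A| * #|P0| <= \sum_(a in A) iso P0 a + K * S)%N.
  move=> sA; rewrite -sum_nat_const.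
  apply: (@leq_trans (\sum_(a in A) (iso P0 a + K * #|alldirs P a|))).
    exact: leq_sum.
  by rewrite big_split -big_distrr leq_add2l leq_mul2l sum_sub ?orbT.
have sumP1 (A : {set 'rV[F]_d}) :
    (K * \sum_(b in A) iso P1 b <= #|A| * (2 * #|P1|))%N.
  by rewrite big_distrr -sum_nat_const; apply: leq_sum.
have [big0|small0] := leqP ((2 * N + 1) * Q) (2 * N * #|P0|).
  have h1 := sumP0 _ sP0; have h2 := iso_pairs_bound P0 oddF qd.
  move: (\sum_(a in P0) _)%N h1 h2 => I h1 h2.
  have [e ce] : exists e, #|P0| = (Q + e)%N.
    exists (#|P0| - Q)%N; rewrite subnKC //.
    by rewrite -(leq_pmul2l (_ : 0 < 2 * N)%N); lia.
  have h3 : (#|F| * (#|P0| * #|P0|) <= #|F| * I + #|F| * (K * S))%N.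
    by rewrite -mulnDr leq_mul2l h1 orbT.
  (* The terms [q Q |P0|] and [Q |P0|] cancel exactly thanks to the sharp isotropic bound; then
     [q <= 2 (q - 1)] gives [h5]. *)
  have h4 : (#|F| * (#|P0| * e) <= #|P0| * e + #|F| * (K * S))%N.
    have e2 : (#|P0| * #|P0| = #|P0| * Q + #|P0| * e)%N by rewrite {2}ce mulnDr.
    by move: h2 h3; rewrite -mulnn e2; lia.
  have h5 : (#|P0| * e <= 2 * (K * S))%N.
    by move: (#|P0| * e)%N (K * S)%N h4 => y z h4; nia.
  have h6 : (Q ^ 2 <= 2 * N * (#|P0| * e))%N.
    rewrite mulnCA -mulnn; apply: leq_mul; first by rewrite ce leq_addr.
    by move: big0; rewrite ce; lia.
  apply: (leq_trans h6); apply: (@leq_trans (2 * N * (2 * (K * S)))).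
    by rewrite leq_mul2l h5 orbT.
  rewrite (_ : 2 * N * _ = 64 * N ^ 2 * S)%N; last by rewrite /K; ring.
  by rewrite leq_mul2r (expnSr N 2); apply/orP; right; nia.
(* Here [#|P1| >= Q / (2N)], and in the first subcase at most 1/8 of the pairs in [P1 x P0] are
   isotropic. *)
have [med0|tiny0] := leqP Q (4 * N * #|P0|).
  have h1 := sumP0 _ sP1; have h2 := sumP1 P0.
  rewrite sum_isoC in h1; move: (\sum_(a in P0) _)%N h1 h2 => I h1 h2.
  have big1 : (Q <= 2 * N * #|P1|)%N by move: P_big; rewrite cP; lia.
  have h3 : (K * (#|P0| * #|P1|) <= 2 * (#|P0| * #|P1|) + K * (K * S))%N.
    have := leq_mul (leqnn K) h1; rewrite mulnDr; lia.
  have h4 : (#|P0| * #|P1| <= 2 * (K * S))%N.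
    move: h3; rewrite /K; move: (#|P0| * #|P1|)%N (16 * N * S)%N => y z h3; nia.
  have h5 : (Q ^ 2 <= 4 * N * #|P0| * (2 * N * #|P1|))%N.
    by rewrite -mulnn leq_mul.
  apply: (leq_trans h5); rewrite mulnACA.
  apply: (@leq_trans (4 * N * (2 * N) * (2 * (K * S)))).
    by rewrite leq_mul2l h4 orbT.
  by rewrite (_ : 4 * N * (2 * N) * _ = 256 * N ^ 3 * S)%N // /K; ring.
(* Now [P0] has fewer than [Q / (4N)] points, so [P1] alone exceeds [Q] by at least [3 Q / (4N)]. *)
have h1 := linear_hashing_dirs P1 k; have h2 := sumP1 P1.
rewrite -eQ big_split /= in h1.
have h3 : (\sum_(a in P1) #|alldirs P1 a| <= S)%N.
  apply: leq_trans (sum_sub _ sP1); apply: leq_sum => a _.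
  exact/subset_leq_card/alldirsS.
move: (\sum_(a in P1) #|_|)%N h1 h3 => S1 h1 h3.
move: (\sum_(a in P1) _)%N h1 h2 => I h1 h2.
have p1_small : (#|P1| <= 2 * Q)%N := leq_trans (subset_leq_card sP1) P_small.
have p1_big : ((4 * N + 3) * Q <= 4 * N * #|P1|)%N.
  by move: P_big; rewrite cP; lia.
have h4 : (4 * N * I <= 2 * Q ^ 2)%N.
  by have := leq_mul p1_small p1_small; move: h2; rewrite /K; lia.
have h5 := leq_mul (leqnn Q) p1_big.
have h6 := leq_mul (leqnn (4 * N)) h1.
have h7 : (Q ^ 2 <= 4 * N * S)%N.
  have h8 := leq_mul (leqnn (4 * N)) h3.
  rewrite -mulnn in h4 h6 *; move: h4 h5 h6 h8.
  by move: (S) #|P1| => T p; clear; lia.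
apply: (leq_trans h7); rewrite leq_mul2r (expnSr N 2); apply/orP; right; nia.
Qed.

(** Averaging over at most [2 * Q] apexes doubles the constant 256. *)
Lemma exists_many_dirs P k (Q := (#|F| ^ k)%N) (N : nat) :
  odd #|F| -> d = (k + k)%N ->
  (0 < N)%N -> (N.+1 * Q <= N * #|P|)%N -> (#|P| <= 2 * Q)%N ->
  exists2 a, a \in P & (Q <= 512 * N ^ 3 * #|alldirs P a|)%N.
Proof.
move=> oddF dk N0 P_big P_small.
have h := sum_dirs_ge (erefl _) oddF dk N0 P_big P_small; rewrite -/Q in h.
have [/exists_inP //|/exists_inPn none] := boolP [exists a in P,
  (Q <= 512 * N ^ 3 * #|alldirs P a|)%N].
have Q0 : (0 < Q)%N by rewrite expn_gt0 ltnW // card_finNzRing_gt1.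
have : (\sum_(a in P) (512 * N ^ 3 * #|alldirs P a|).+1 <= \sum_(a in P) Q)%N.
  by apply: leq_sum => a /none; rewrite -ltnNge.
rewrite sum_nat_const; under eq_bigr => a _ do rewrite -addn1.
rewrite big_split -big_distrr /= sum1_card.
have cP0 : (0 < #|P|)%N.
  by rewrite lt0n; apply/eqP => p0; move: P_big; rewrite p0; lia.
have := leq_mul P_small (leqnn Q).
move: h cP0; rewrite -mulnn; move: (\sum_(a in P) _)%N (N ^ 3)%N #|P| (Q).
by clear => S M p Q; lia.
Qed.

End NonSquare.

(** * From directions to spreads *)

(** Scalars cancel in a spread, so directions [u], [v] of norm [t] give [1 - (u . v)^2 / t^2], at
    most two-to-one in [u . v]. Few collisions at [u] mean many products. *)
Lemma spreads_of_dirs P a t (C Q : nat) : t != 0 -> (#|F| ^ d = Q ^ 2)%N ->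
  (0 < Q)%N -> a \in P -> (Q <= C * #|dirs t P a|)%N ->
  (#|F| <= 2 * (1 + 2 * C ^ 2) * #|spreads P|)%N.
Proof.
move=> t0 qd Q0 aP; set E := dirs t P a => hE.
have E0 : E != set0 by rewrite -card_gt0; nia.
have normE v : v \in E -> normv v = t by rewrite inE => /andP [/eqP].
have [u uE hu] := pinned_collisions t0 normE E0.
pose D := [set dotv u v | v in E].
have hD : (#|E| ^ 2 <= #|D| * coll (dotv u) E)%N.
  by apply: coll_ge => v vE; apply: imset_f.
have hS : (#|D| <= 2 * #|spreads P|)%N.
  apply: (leq_card_fibers (f := fun z => 1 - z ^+ 2 / t ^+ 2)) => [z|z].
    case/imsetP => v vE ->.
    have dirE w : w \in E ->
        exists2 b, b \in P & exists2 s, s != 0 & b = a + s *: w.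
      rewrite inE => /andP [_ /exists_inP [b bP]].
      case/existsP=> s /andP [s0 /eqP e].
      by exists b => //; exists s.
    have [b bP [s s0 eb]] := dirE u uE; have [c cP [r r0 ec]] := dirE v vE.
    have eba : b - a = s *: u by rewrite eb addrC addKr.
    have eca : c - a = r *: v by rewrite ec addrC addKr.
    rewrite inE; apply/exists_inP; exists a => //.
    apply/exists_inP; exists b => //; apply/exists_inP; exists c => //.
    rewrite /spread_defined /spread eba eca !normvZ !normE //.
    rewrite !mulf_neq0 ?expf_neq0 //=; apply/eqP; rewrite dotvZl dotvZr.
    by field; rewrite ?s0 ?r0 ?t0.
  have ti0 : (t ^+ 2)^-1 != 0 by rewrite invr_neq0 ?expf_neq0.
  apply: leq_trans (card_quadratic_roots 0 (z - 1) ti0).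
  apply/subset_leq_card/subsetP => y; rewrite !inE => /andP [_ /eqP <-].
  by apply/eqP; ring.
have EQ : (Q ^ 2 <= C ^ 2 * #|E| ^ 2)%N by rewrite -expnMn leq_exp2r.
have e0 : (0 < #|E| ^ 2)%N by rewrite expn_gt0 card_gt0 E0.
rewrite qd in hu.
have h1 : (#|F| * #|E| ^ 2 <= #|D| * (#|F| * coll (dotv u) E))%N by nia.
have h2 : (#|F| * coll (dotv u) E <= (1 + 2 * C ^ 2) * #|E| ^ 2)%N by lia.
have h3 : (#|F| * #|E| ^ 2 <= #|D| * (1 + 2 * C ^ 2) * #|E| ^ 2)%N.
  by rewrite -mulnA; apply: leq_trans h1 _; rewrite leq_mul2l h2 orbT.
rewrite leq_pmul2r // in h3; apply: leq_trans h3 _.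
by rewrite mulnAC leq_mul2r hS orbT.
Qed.

Lemma spreadsS P P' : P \subset P' -> spreads P \subset spreads P'.
Proof.
move=> /subsetP sPP'; apply/subsetP => s; rewrite !inE.
case/exists_inP => a aP /exists_inP [b bP /exists_inP [c cP h]].
apply/exists_inP; exists a; first exact: sPP'.
apply/exists_inP; exists b; first exact: sPP'.
by apply/exists_inP; exists c; first exact: sPP'.
Qed.

Lemma spreads_ge P k (Q := (#|F| ^ k)%N) (N : nat) :
  odd #|F| -> d = (k + k)%N ->
  (0 < N)%N -> (N.+1 * Q <= N * #|P|)%N ->
  (#|F| <= 2 * (1 + 2 * (1024 * N ^ 3) ^ 2) * #|spreads P|)%N.
Proof.
move=> oddF dk N0 P_big.
have [g g0 gP] := square_classes.
have qd : (#|F| ^ d = Q ^ 2)%N by rewrite dk expnD mulnn.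
have Q0 : (0 < Q)%N by rewrite expn_gt0 ltnW // card_finNzRing_gt1.
(* Truncation to [2 * Q] points preserves the lower bound because [N.+1 <= 2 * N]. *)
have [P' sP' cP'] := subset_of_card (geq_minl #|P| (2 * Q)).
have P'_big : (N.+1 * Q <= N * #|P'|)%N.
  by rewrite cP' /minn; case: ifP => // _; rewrite mulnA leq_mul2r; lia.
have P'_small : (#|P'| <= 2 * Q)%N by rewrite cP' geq_minr.
have [a aP' ha] := exists_many_dirs g0 gP oddF dk N0 P'_big P'_small.
rewrite -/Q in ha.
have main t : t != 0 -> (Q <= 1024 * N ^ 3 * #|dirs t P' a|)%N ->
    (#|F| <= 2 * (1 + 2 * (1024 * N ^ 3) ^ 2) * #|spreads P|)%N.
  move=> t0 ht; apply: leq_trans (spreads_of_dirs t0 qd Q0 aP' ht) _.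
  by rewrite leq_mul2l subset_leq_card ?spreadsS ?orbT.
have := leq_card_setU (dirs 1 P' a) (dirs g P' a).
rewrite -/(alldirs g P' a) => hU.
(* One of the two norms accounts for at least half of the directions, whence 1024. *)
have [/main h1|h1] := leqP Q (1024 * N ^ 3 * #|dirs 1 P' a|).
  by apply: h1; apply: oner_neq0.
have := leq_mul (leqnn (N ^ 3)%N) hU; rewrite mulnDr => hN.
by apply: (main g g0); lia.
Qed.

End Geometry.

Theorem theorem1p4 (R : realType) (d : nat) (hd2 : (2 <= d)%N) (hd : ~~ odd d)
    (eps : R) (heps : 0 < eps) :
  exists2 c : R, 0 < c &
    forall (F : finFieldType) (P : {set 'rV[F]_d}),
      odd #|F| ->
      (1 + eps) * (#|F| ^ d./2)%:R <= #|P|%:R ->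
      c * #|F|%:R <= #|spreads P|%:R.
Proof.
(* This [N] exceeds [1/eps], so [1 + 1/N <= 1 + eps]; [C] depends on [eps] only. *)
pose N := (Num.truncn eps^-1).+1.
pose C := (2 * (1 + 2 * (1024 * N ^ 3) ^ 2))%N.
have C0 : 0 < C%:R :> R by rewrite ltr0n.
exists C%:R^-1; first by rewrite invr_gt0.
move=> F P oddF P_big; rewrite mulrC ler_pdivrMr // -natrM ler_nat mulnC.
apply: (@spreads_ge F d P d./2) => //.
  by rewrite addnn even_halfK.
have Ne : 1 <= N%:R * eps.
  by rewrite mulrC -ler_pdivrMl // mulr1 ltW // truncnS_gt.
rewrite -(ler_nat R) !natrM -addn1 natrD.
have := ler_wpM2l (ler0n R N) P_big; apply: le_trans.
rewrite mulrA ler_wpM2r //; lra.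
Qed.
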